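(* Let $n\ge 6$ and $k\ge 1$ be integers, and let $\mathcal{V}^k_n$ be the class of all simple bipartite graphs on $n$ vertices with vertex connectivity exactly $k$. Let $G$ be a graph in $\mathcal{V}^k_n$ attaining the maximum value of $M_1$ over $\mathcal{V}^k_n$ (respectively, the maximum value of $M_2$ over $\mathcal{V}^k_n$). Then: (i) if $n$ is odd, $G\cong O_k\vee_1\big(K_1\cup K_{\frac{n-1}{2},\frac{n-1-2k}{2}}\big)$; (ii) if $n$ is even and $k=\frac{n}{2}$, then $G\cong K_{\frac n2,\frac n2}$; if $n$ is even and $k\le \frac n2-1$, then $G\cong O_k\vee_1\big(K_1\cup K_{\frac{n}{2},\frac{n-2-2k}{2}}\big)$.
   Context: All graphs are finite, simple and undirected. For a graph $G$, the first Zagreb index is $M_1(G)=\sum_{u\in V(G)} d(u)^2$ and the second Zagreb index is $M_2(G)=\sum_{uv\in E(G)} d(u)d(v)$, where $d(u)$ is the degree of $u$. The (vertex) connectivity $\kappa(G)$ is the largest integer $k$ such that $|V(G)|>k$ and $G-X$ is connected for every $X\subseteq V(G)$ with $|X|<k$. $K_{p,q}$ denotes the complete bipartite graph with parts of sizes $p$ and $q$; by convention $K_{p,0}$ ($p\ge1$) is the empty graph $pK_1$ on $p$ vertices. For positive integers $n\ge r\ge k$, the graph $O_k\vee_1(K_1\cup K_{n-r-1,r-k})$ is defined as follows: take an independent set $C$ of $k$ vertices (the empty graph $O_k$), a single vertex $v$, and a complete bipartite graph $K_{n-r-1,r-k}$ with parts $A$ of size $n-r-1$ and $B$ of size $r-k$;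 add all edges between $C$ and $v$ and all edges between $C$ and $A$. This graph has $n$ vertices. *)

(* Defs.v *)
From mathcomp Require Import all_boot.

Set Implicit Arguments.
Unset Strict Implicit.
Unset Printing Implicit Defensive.

Record sgraph := SGraph {
  vertex :> finType;
  adj : rel vertex;
  adj_sym : symmetric adj;
  adj_irrefl : irreflexive adj }.

Definition isomorphic (G H : sgraph) : Prop :=
  exists2 f : G -> H, bijective f & forall x y, adj (f x) (f y) = adj x y.

Section GraphNotions.
Variable G : sgraph.

Definition degree (u : G) : nat := #|[set v : G | adj u v]|.

Definition edges : {set {set G}} :=
  [set [set x; y] | x in [set: G], y in [set: G] & adj x y].

Definition zagreb1 : nat := \sum_(u : G) degree u ^ 2.

(* An edge uv is the two-element set {u, v}, so the inner product is
   d(u) d(v) and every edge is counted once. *)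
Definition zagreb2 : nat := \sum_(e in edges) \prod_(u in e) degree u.

Definition bipartite : bool :=
  [exists A : {set G}, forall x, forall y,
     adj x y ==> ((x \in A) != (y \in A))].

Definition connected : bool := [forall x : G, forall y : G, connect (@adj G) x y].

End GraphNotions.

Section Deletion.
Variables (G : sgraph) (X : {set G}).

Definition del_adj : rel {x : G | x \notin X} := fun x y => adj (val x) (val y).

Lemma del_adj_sym : symmetric del_adj.
Proof. by move=> x y; apply: adj_sym. Qed.

Lemma del_adj_irrefl : irreflexive del_adj.
Proof. by move=> x; apply: adj_irrefl. Qed.

Definition delete : sgraph := SGraph del_adj_sym del_adj_irrefl.

End Deletion.

(* The index type 'I_#|V(G)| of the maximum encodes |V(G)| > k; the value
   k = 0 always qualifies when G has a vertex. *)
Definition connectivity (G : sgraph) : nat :=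
  \max_(k < #|vertex G| |
        [forall X : {set G}, (#|X| < k) ==> connected (delete X)]) k.

Section CompleteBipartite.
Variables p q : nat.

Definition Kpq_adj : rel ('I_p + 'I_q)%type := fun x y =>
  match x, y with
  | inl _, inr _ | inr _, inl _ => true
  | _, _ => false
  end.

Lemma Kpq_adj_sym : symmetric Kpq_adj.
Proof. by case=> ? [] ?. Qed.

Lemma Kpq_adj_irrefl : irreflexive Kpq_adj.
Proof. by case. Qed.

Definition Kpq : sgraph := SGraph Kpq_adj_sym Kpq_adj_irrefl.

End CompleteBipartite.

(* O_k \/_1 (K_1 U K_{p,q}).  The vertices are C = 'I_k, v = tt, and the
   vertices of K_{p,q}, with A = 'I_p and B = 'I_q; C is completely joined to
   v and to A, but not to B. *)
Section JoinOne.
Variables k p q : nat.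

Definition join1_adj : rel ('I_k + (unit + Kpq p q))%type := fun x y =>
  match x, y with
  | inl _, inr (inl _) | inr (inl _), inl _ => true
  | inl _, inr (inr (inl _)) | inr (inr (inl _)), inl _ => true
  | inr (inr a), inr (inr b) => adj a b
  | _, _ => false
  end.

Lemma join1_adj_sym : symmetric join1_adj.
Proof. by move=> [?|[?|[?|?]]] [?|[?|[?|?]]]. Qed.

Lemma join1_adj_irrefl : irreflexive join1_adj.
Proof. by move=> [?|[?|[?|?]]]. Qed.

Definition join1 : sgraph := SGraph join1_adj_sym join1_adj_irrefl.

End JoinOne.

(* The class V_n^k of bipartite graphs of order n and connectivity exactly k. *)
Definition in_class (n k : nat) (G : sgraph) : Prop :=
  [/\ #|vertex G| = n, bipartite G & connectivity G = k].

Definition maximizes (M : sgraph -> nat) (P : sgraph -> Prop) (G : sgraph) : Prop :=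
  P G /\ forall H, P H -> M H <= M G.

(* Main.v *)
Require Import Defs.
From mathcomp Require Import all_boot zify.

Set Implicit Arguments.
Unset Strict Implicit.
Unset Printing Implicit Defensive.

(* Both indices of a bipartite graph are sums of [w (d u) (d v)] over its edges
   [uv], with [w] the addition for M_1 and the multiplication for M_2, so they
   are treated together.  Put s0 = floor(n/2), q0 = floor((n-1)/2).  Connectivity
   k forces minimum degree at least k.

   If some vertex v has degree exactly k, let 1 + s be the size of its side and
   q that of the other one.  G is contained in K_{s+1,q} with v joined to only k
   vertices, so its index is at most a value [extremal_value w k s q], with
   equality only if no edge is missing; among s + q = n - 1 this value is
   largest only at (s0, q0), where it is attained by the claimed graph.

   Otherwise all degrees exceed k and a cut X of size k splits G - X into two
   pieces without edges in between, each with more vertices on a side than X has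
   on the opposite side.  An edge inside X has weight at most 2 W and any other edge
   at most W, where W = w q0 s0; counting edges then gives an index of at most
   W (s0 q0 + k), which is below the extremal value. *)

(** * Arithmetic of the extremal value and of products with bounded sum *)

(* The index of [join1 k s (q - k)]. *)
Definition extremal_value (w : nat -> nat -> nat) k s q :=
  k * w k s.+1 + s * (k * w q s.+1 + (q - k) * w q s).

Lemma extremal_valueD k s q : k <= q ->
  extremal_value addn k s q = k * (k + 2 * s + 1) + s * q * (s + q).
Proof.
by rewrite /extremal_value => /subnKC <-; rewrite addKn; nia.
Qed.

Lemma extremal_valueM k s q : k <= q ->
  extremal_value muln k s q = k ^ 2 * s.+1 + s * q * (k + s * q).
Proof.
by rewrite /extremal_value => /subnKC <-; rewrite addKn; nia.
Qed.

(** The balanced product changes by (s0 + j)(q0 - j) = s0 q0 - j (s0 - q0) - j^2, where s0 - q0 is 0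
    or 1. A loss of j is recorded only for s above s0, where it has to outweigh the growth of the
    part of the extremal value that is linear in s. *)
Lemma split_product n s q : s + q = n.-1 ->
  (exists2 j, s = n./2 + j /\ n.-1./2 = q + j & s * q + j <= n.-1./2 * n./2)
  \/ (exists2 j, n./2 = s + j.+1 & s * q <= n.-1./2 * n./2).
Proof.
move=> sq.
have e : n./2 + n.-1./2 = n.-1 by lia.
have b : n.-1./2 <= n./2 <= n.-1./2.+1 by lia.
case: (leqP n./2 s) => h; [left; exists (s - n./2) | right; exists (n./2 - s).-1]; try lia.
  set j := s - n./2.
  have -> : s = n./2 + j by lia.
  have -> : n.-1./2 = q + j by lia.
  nia.
have [j ej] : exists j, n./2 = s + j.+1 by exists (n./2 - s).-1; lia.
have -> : q = n.-1./2 + j.+1 by lia.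
rewrite ej in b *; nia.
Qed.

Lemma extremal_valueD_lt n k s q : 0 < k <= q -> k <= n.-1./2 -> s + q = n.-1 ->
  s != n./2 -> extremal_value addn k s q < extremal_value addn k n./2 n.-1./2.
Proof.
move=> /andP[k0 kq] kn sq sn; rewrite !extremal_valueD //.
have -> : n./2 + n.-1./2 = n.-1 by lia.
rewrite sq.
(* For s = s0 + j the linear term gains 2 k j and the product term loses at least j (n - 1); for s <
   s0 the linear term drops. *)
have [[j [sj qj] h]|[j sj h]] := split_product sq.
  have j0 : 0 < j by lia.
  have : 2 * k < n.-1 by lia.
  rewrite sj in h *; nia.
rewrite sj in h *; nia.
Qed.

Lemma extremal_valueM_lt n k s q : 0 < k <= q -> k <= n.-1./2 -> s + q = n.-1 ->
  s != n./2 -> extremal_value muln k s q < extremal_value muln k n./2 n.-1./2.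
Proof.
move=> /andP[k0 kq] kn sq sn; rewrite !extremal_valueM //.
have [[j [sj qj] h]|[j sj h]] := split_product sq.
  have j0 : 0 < j by lia.
  (* With N = s0 q0 and M = s q, the first term gains k^2 j <= N j, while M (k + M) is at least j (k
     + N) below N (k + N): the net loss is at least j k. *)
  have kN : k ^ 2 <= n.-1./2 * n./2 by rewrite -mulnn; apply: leq_mul; lia.
  rewrite [n./2 * _]mulnC; set N := _ * n./2 in h kN *; rewrite sj in h *.
  set M := (n./2 + j) * q in h *.
  set c := k ^ 2 in kN *.
  have -> : c * (n./2 + j).+1 = c * n./2.+1 + c * j by lia.
  have : c * j <= N * j by rewrite leq_mul2r kN orbT.
  have : M * (k + M) <= (N - j) * (k + N) by apply: leq_mul; lia.
  have : (N - j) * (k + N) + j * (k + N) = N * (k + N) by rewrite -mulnDl subnK //; lia.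
  have : 0 < j * k by rewrite muln_gt0 j0.
  lia.
have : s * q * (k + s * q) <= n./2 * n.-1./2 * (k + n./2 * n.-1./2).
  by apply: leq_mul; lia.
suff : k ^ 2 * s.+1 < k ^ 2 * n./2.+1 by lia.
rewrite ltn_pmul2l ?expn_gt0 ?k0 //; lia.
Qed.

(** The margin is k (k + 2 s0 + 1 - (s0 + q0)), positive because q0 <= s0. *)
Lemma extremal_valueD_gt n k : 0 < k <= n.-1./2 ->
  (n.-1./2 + n./2) * (n.-1./2 * n./2 + k) < extremal_value addn k n./2 n.-1./2.
Proof.
by move=> /andP[k0 kn]; rewrite extremal_valueD //; nia.
Qed.

Lemma extremal_valueM_gt n k : 0 < k <= n.-1./2 ->
  (n.-1./2 * n./2) * (n.-1./2 * n./2 + k) < extremal_value muln k n./2 n.-1./2.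
Proof.
move=> /andP[k0 kn]; rewrite extremal_valueM // [n./2 * _]mulnC [k + _]addnC.
by rewrite -[X in X < _]add0n ltn_add2r muln_gt0 expn_gt0 k0.
Qed.

Lemma muln_half_pred n x y : x + y <= n.-1 -> x * y <= n.-1./2 * n./2.
Proof.
move=> h.
wlog xy : x y h / x <= y => [W|].
  by case: (leqP x y) => [|/ltnW] xy; [|rewrite mulnC]; apply: W => //; rewrite addnC.
have [j ej] : exists j, n.-1./2 = x + j by exists (n.-1./2 - x); lia.
have : y <= n./2 + j by lia.
have : n.-1./2 <= n./2 <= n.-1./2.+1 by lia.
have [e|l] := leqP y n./2; first by move=> _ _; apply: leq_mul; lia.
have [i ei] : exists i, y = n./2 + i.+1 by exists (y - n./2).-1; lia.
rewrite ej ei; nia.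
Qed.

(** Taking 1 off the larger factor y = z + 1 reduces to sum n - 1: x y = x z + x <= 2 x z once z >
    0, and z = 0 leaves x y <= 1. *)
Lemma muln_half n x y : 2 < n -> x + y <= n -> x * y <= 2 * (n.-1./2 * n./2).
Proof.
move=> n3 h; case: (posnP x) => [->|x0]; first lia.
case: (posnP y) => [->|y0]; first lia.
wlog xy : x y h x0 y0 / x <= y => [W|].
  by case: (leqP x y) => [|/ltnW] xy; [|rewrite mulnC]; apply: W => //; rewrite addnC.
case: y y0 h xy => // z _ h xy.
have b : x * z <= n.-1./2 * n./2 by apply: muln_half_pred; lia.
have N0 : 0 < n.-1./2 * n./2 by rewrite muln_gt0; lia.
by case: z xy h b => [|z] xy h b; [|rewrite mulnS in b *]; nia.
Qed.

(* Writing [a_i = x2 + 1 + c_i] and [b_i = x1 + 1 + e_i], four times the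
   difference of the two sides is at least k^2 + 6 k + 2 (k + 1) (c + e),
   c and e being the sums of the [c_i] and [e_i]. *)
Lemma two_component_bound n k a1 a2 b1 b2 x1 x2 :
  x1 + x2 = k -> x2 < a1 -> x2 < a2 -> x1 < b1 -> x1 < b2 ->
  a1 + a2 + x1 + (b1 + b2 + x2) = n ->
  x1 * (b1 + b2 + x2 + x2) + (a1 * (b1 + x2) + a2 * (b2 + x2))
    <= n.-1./2 * n./2 + k.
Proof.
move=> xk /subnKC; set c1 := (a1 - _) => <- /subnKC; set c2 := (a2 - _) => <-.
move=> /subnKC; set e1 := (b1 - _) => <- /subnKC; set e2 := (b2 - _) => <- en.
clearbody c1 c2 e1 e2; clear a1 a2 b1 b2.
have nE : n = 3 * k + 4 + (c1 + c2 + (e1 + e2)) by lia.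
(* The product of the halves is n (n - 2) / 4 for even n and (n - 1)^2 / 4 for odd n. *)
have N4 : n * n <= 4 * (n.-1./2 * n./2) + 2 * n.
  have [r [e [e1' [-> [-> ->]]]]] : exists r e, e <= 1 /\
      n.-1./2 = r /\ n./2 = r + e /\ n = r + (r + e) + 1.
    by exists n.-1./2, (n./2 - n.-1./2); lia.
  have : e * e <= 1 by case: e e1' => [|[]].
  lia.
set N := _ * n./2 in N4 *.
set S := c1 + c2 + (e1 + e2) in nE.
have S4 : 4 * (c1 * e1 + c2 * e2) <= S * S.
  have : 4 * ((c1 + c2) * (e1 + e2)) <= S * S.
    by rewrite mulnn; apply: nat_AGM2.
  by apply: leq_trans; rewrite leq_mul2l /=; lia.
set L := (X in X <= _).
have -> : L = (k + 1) * S + (c1 * e1 + c2 * e2) + 2 * (k * k) + 4 * k + 2.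
  by rewrite /L /S -xk; lia.
have kS : 0 <= k * S by [].
rewrite nE in N4; lia.
Qed.

(** * Zagreb indices as edge sums over one side of a bipartition *)

Section Bipartition.
Variable G : sgraph.
Implicit Types (P X : {set G}) (w : nat -> nat -> nat).

Definition bipartition P := forall x y : G, adj x y -> (x \in P) != (y \in P).

Lemma bipartitionC P : bipartition P -> bipartition (~: P).
Proof. by move=> bP x y /bP; rewrite !inE; case: (x \in P); case: (y \in P). Qed.

Lemma bipartitionP : reflect (exists P, bipartition P) (bipartite G).
Proof.
apply: (iffP existsP) => [[P /forallP bP]|[P bP]]; exists P.
  by move=> x y; move/forallP/(_ y)/implyP: (bP x).
by apply/forallP => x; apply/forallP => y; apply/implyP/bP.
Qed.

Lemma sum_adj_const (u : G) c : \sum_(v | adj u v) c = degree u * c.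
Proof. by rewrite sum_nat_cond_const /degree cardsE. Qed.

(** When [P] is a side of a bipartition, starting each edge at its end in [P] counts it once. *)
Definition edge_sum w P :=
  \sum_(u in P) \sum_(v | adj u v) w (degree u) (degree v).

(** Each u contributes d(u) at each of its d(u) edges; the contributions from outside [P] are
    collected by exchanging the sums. *)
Lemma zagreb1_edge_sum P : bipartition P -> zagreb1 G = edge_sum addn P.
Proof.
move=> bP; rewrite /edge_sum.
under eq_bigr => u _ do rewrite big_split /= sum_adj_const.
rewrite big_split /= /zagreb1 (bigID [in P]) /=; congr (_ + _).
rewrite (exchange_big_dep (fun v => v \notin P)) /=; last first.
  by move=> u v uP /bP; rewrite uP.
apply: eq_bigr => v vP; rewrite (eq_bigl (adj v)) ?sum_adj_const // => u.
rewrite adj_sym andbC; case E: (adj v u) => //=.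
by move/bP: E; rewrite (negPf vP); case: (u \in P).
Qed.

(** An edge has exactly one end in [P], so edges correspond bijectively to adjacent pairs with first
    component in [P]. *)
Lemma zagreb2_edge_sum P : bipartition P -> zagreb2 G = edge_sum muln P.
Proof.
move=> bP; rewrite /edge_sum pair_big_dep /=.
pose E := [set z : G * G | (z.1 \in P) && adj z.1 z.2].
pose f (z : G * G) := [set z.1; z.2].
have -> : \sum_(p | (p.1 \in P) && adj p.1 p.2) degree p.1 * degree p.2 =
          \sum_(z in E) \prod_(x in f z) degree x.
  apply: eq_big => [z|[x y] /andP[/= xP xy]]; first by rewrite inE.
  rewrite big_setU1 ?big_set1 //= inE; apply: contraTneq xy => ->.
  by rewrite adj_irrefl.
rewrite -(big_imset (fun e : {set G} => \prod_(x in e) degree x)) /=; last first.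
  move=> [x y] [x' y']; rewrite !inE /f /= => /andP[xP /bP xy] /andP[xP' /bP xy'] e.
  have yP : y \notin P by move: xy; rewrite xP; case: (y \in P).
  have yP' : y' \notin P by move: xy'; rewrite xP'; case: (y' \in P).
  have /set2P[->|xE] : x \in [set x'; y'] by rewrite -e set21.
    have /set2P[yE|->//] : y \in [set x'; y'] by rewrite -e set22.
    by rewrite yE xP' in yP.
  by rewrite -xE xP in yP'.
rewrite /zagreb2; apply: eq_bigl => e; apply/imset2P/imsetP.
  case=> x y _; rewrite inE => /andP[_ xy] ->.
  case xP: (x \in P); first by exists (x, y); rewrite ?inE /= ?xP.
  exists (y, x); rewrite ?inE /= ?[adj y x]adj_sym ?xy /f /= 1?setUC //.
  by move/bP: xy; rewrite xP; case: (y \in P).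
case=> [[x y]]; rewrite inE /= => /andP[xP xy] ->.
by exists x y; rewrite ?inE.
Qed.

Lemma degree_cover P (B : {set G}) u :
  bipartition P -> u \in P -> (forall v, adj u v -> v \in B) ->
  degree u <= #|B :\: P|.
Proof.
move=> bP uP uB; apply/subset_leq_card/subsetP => v; rewrite !inE => uv.
by rewrite uB // andbT; move/bP: uv; rewrite uP; case: (v \in P).
Qed.

Lemma degree_side P u : bipartition P -> u \in P -> degree u <= #|~: P|.
Proof. by move=> bP uP; rewrite -setTD; apply: degree_cover. Qed.

End Bipartition.

(** * Connectivity, minimum degree and cuts *)

Section Connectivity.
Variable G : sgraph.

Definition kconnected k :=
  [forall X : {set G}, (#|X| < k) ==> connected (delete X)].

(** If d(v) < k, deleting the neighbours of v removes fewer than k vertices and isolates v, while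
    [k < #|G|] leaves another vertex. *)
Lemma kconnected_degree k (v : G) : kconnected k -> k < #|G| -> k <= degree v.
Proof.
move=> /forallP/(_ [set u | adj v u])/implyP kc kG; rewrite leqNgt; apply/negP => dk.
have vX : v \notin [set u | adj v u] by rewrite inE adj_irrefl.
have [u] : exists u, u \notin v |: [set u | adj v u].
  apply/existsP; rewrite -negb_forall; apply/negP => /forallP h.
  suff: #|G| <= (degree v).+1 by lia.
  rewrite -[X in _ <= X]add1n -(cards1 v); apply: leq_trans (leq_card_setU _ _).
  by rewrite -cardsT; apply/subset_leq_card/subsetP.
rewrite in_setU1 negb_or => /andP[uv uX].
move/forallP/(_ (Sub v vX))/forallP/(_ (Sub u uX))/connectP: (kc dk) => [[|y p]] /=.
  by move=> _ /(congr1 val)/= e; rewrite e eqxx in uv.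
case/andP => vy _ _; move: (valP y); rewrite inE; case/negP.
exact: vy.
Qed.

(** A maximum over an empty range would be 0, so [0 < k] ensures that it is attained at some
    index. *)
Lemma connectivity_pos k : 0 < k -> connectivity G = k ->
  [/\ k < #|G|, kconnected k & forall j, k < j < #|G| -> ~~ kconnected j].
Proof.
move=> k0 cG.
have [i0 [i0k ic]] : exists i0 : 'I_#|G|, i0 = k :> nat /\ kconnected i0.
  have [|i ci ei] := eq_bigmax_cond (nat_of_ord (n := #|G|)) (A := fun i : 'I_#|G| => kconnected i).
    rewrite lt0n; apply/negP => /eqP/card0_eq e.
    by move: cG k0; rewrite /connectivity big_pred0 // => <-.
  by exists i; split; [rewrite -ei -cG | exact: ci].
rewrite -i0k; split=> // j /andP[ij jG]; apply/negP => jc.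
have := leq_bigmax_cond (P := fun i : 'I_#|G| => kconnected i) (F := @nat_of_ord _) (Ordinal jG) jc.
move: cG; rewrite /connectivity => -> /=; lia.
Qed.

Lemma connectivity_eq k : k < #|G| -> kconnected k ->
  (exists v : G, degree v <= k) -> connectivity G = k.
Proof.
move=> kG kc [v vk]; apply/eqP; rewrite eqn_leq; apply/andP; split.
  apply/bigmax_leqP => i /kconnected_degree-/(_ v (ltn_ord i)).
  by move/leq_trans; apply.
exact: (leq_bigmax_cond (P := fun i : 'I_#|G| => kconnected i) (F := @nat_of_ord _) (Ordinal kG)).
Qed.

Lemma disconnected_delete (X : {set G}) : ~~ connected (delete X) ->
  exists2 H : {set G}, [disjoint H & X] /\
     (exists x, x \in H) /\ (exists y, y \notin H :|: X) &
     forall x y, x \in H -> adj x y -> y \in H :|: X.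
Proof.
rewrite negb_forall => /existsP[x]; rewrite negb_forall => /existsP[y nxy].
(* The witness is the component of [x] in G - X, carried back to G. *)
exists [set val z | z in connect (@adj (delete X)) x]; last first.
  move=> x' z /imsetP[u xu ->{x'}] uz; rewrite inE; case: (boolP (z \in X)) => zX; first by rewrite orbT.
  rewrite orbF; apply/imsetP; exists (Sub z zX); last by [].
  by apply: connect_trans xu _; apply: connect1.
split; first by apply/pred0P => x' /=; apply/andP => -[/imsetP[u _ ->]]; apply/negP; exact: (valP u).
split; first by exists (val x); apply/imsetP; exists x => //; apply: connect0.
exists (val y); rewrite inE negb_or (valP y) andbT; apply/imsetP => -[u xu /val_inj e].
by move: nxy; rewrite e => /negP; apply.
Qed.

End Connectivity.

(** * Upper bounds on the edge sum *)

Section UpperBounds.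
Variables (w : nat -> nat -> nat) (G : sgraph) (P : {set G}).
Hypothesis bP : bipartition P.

Section SmallDegree.
Hypothesis w_mono : forall x y x' y', x <= x' -> y <= y' -> w x y <= w x' y'.
Hypothesis w_gt0 : forall x y, 0 < x -> 0 < y -> 0 < w x y.

(* The double sum counts, one by one, the edges that G could still receive away
   from [v0]; it makes the equality case readable off the bound. *)
Lemma edge_sum_le_extremal v0 : v0 \in P -> degree v0 <= #|~: P| ->
  edge_sum w P
    + \sum_(u in P | u != v0) \sum_(v | (v \notin P) && ~~ adj u v) 1
    <= extremal_value w (degree v0) #|P :\ v0| #|~: P|.
Proof.
move=> v0P kq; set k := degree v0; set s := #|P :\ v0|; set q := #|~: P|.
have Ps : #|P| = s.+1 by rewrite (cardsD1 v0) v0P.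
have degP u : u \in P -> degree u <= q.
  exact: degree_side.
have degQ v : v \notin P -> degree v <= s.+1.
  move=> vP; have := degree_side (u := v) (bipartitionC bP).
  by rewrite setCK Ps; apply; rewrite inE.
have degQ' v : v \notin P -> ~~ adj v0 v -> degree v <= s.
  move=> vP nv; have -> : s = #|(~: [set v0]) :\: ~: P|.
    by apply: eq_card => z; rewrite !inE negbK andbC.
  apply: (degree_cover (bipartitionC bP)); rewrite ?inE // => z vz.
  by rewrite !inE; apply: contraTneq vz => ->; rewrite adj_sym.
have adjP u v : u \in P -> adj u v -> v \notin P.
  by move=> uP /bP; rewrite uP; case: (v \in P).
rewrite /edge_sum (bigD1 v0) //= -addnA; apply: leq_add.
  rewrite -(sum_adj_const v0); apply: leq_sum => v v0v.
  by apply: w_mono => //; apply: degQ; apply: adjP v0v.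
rewrite -big_split /=.
have sE : s = \sum_(u in P | u != v0) 1.
  by rewrite sum1_card; apply: eq_card => z; rewrite !inE andbC.
rewrite [X in _ <= X * _]sE big_distrl /=; apply: leq_sum => u /andP[uP uv0]; rewrite mul1n.
have s_gt0 : 0 < s by rewrite card_gt0; apply/set0Pn; exists u; rewrite !inE uv0.
(* [b v] bounds the weight of an edge [uv], since a non-neighbour of [v0] has degree at most [s].
   Summed over the whole opposite side it pays for the edges at [u] and, being positive, at least 1
   for each missing one. *)
pose b v := if adj v0 v then w q s.+1 else w q s.
have -> : k * w q s.+1 + (q - k) * w q s = \sum_(v | v \notin P) b v.
  rewrite (bigID (adj v0)) /=; congr (_ + _).
    rewrite -sum_adj_const; apply: eq_big => [v|v v0v]; last by rewrite /b v0v.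
    by case v0v: (adj v0 v); rewrite ?andbF // andbT (adjP _ _ v0P).
  rewrite (eq_bigr (fun=> w q s)) => [|v /andP[_ /negPf nv]]; last by rewrite /b nv.
  rewrite sum_nat_cond_const; congr (_ * _).
  have -> : k = #|[set v | adj v0 v]| by [].
  rewrite /q -(cardsID [set v | adj v0 v] (~: P)).
  have -> : ~: P :&: [set v | adj v0 v] = [set v | adj v0 v].
    by apply/setIidPr/subsetP => v; rewrite !inE; apply: adjP.
  by rewrite addKn; apply: eq_card => v; rewrite !inE andbC.
rewrite [X in _ <= X](bigID (adj u)) /=.
rewrite (eq_bigl (fun v => (v \notin P) && adj u v)); last first.
  by move=> v; case uv: (adj u v); rewrite ?andbF // andbT (adjP _ _ uP).
apply: leq_add; apply: leq_sum => v /andP[vP uv]; rewrite /b.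
  case: ifP => v0v; apply: w_mono; rewrite ?degP ?degQ //.
  by apply: degQ' => //; rewrite v0v.
have q_gt0 : 0 < q by rewrite card_gt0; apply/set0Pn; exists v; rewrite !inE.
by case: ifP => _; apply: w_gt0.
Qed.

End SmallDegree.

Section TwoComponents.
Variables (W : nat) (H X : {set G}).
Hypothesis W_off : forall x y, x + y <= #|G|.-1 -> w x y <= W.
Hypothesis W_on : forall x y, x + y <= #|G| -> w x y <= 2 * W.
Hypothesis HX : [disjoint H & X].
Hypothesis H_nonempty : exists x, x \in H.
Hypothesis H'_nonempty : exists y, y \notin H :|: X.
Hypothesis H_closed : forall x y, x \in H -> adj x y -> y \in H :|: X.
Hypothesis deg_gt : forall x : G, #|X| < degree x.

Let H' := ~: (H :|: X).

Lemma component_compl_closed x y : x \in H' -> adj x y -> y \in H' :|: X.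
Proof.
rewrite !inE => /norP[xH xX] xy; case yH: (y \in H); last by case: (y \in X).
by move: (@H_closed y x yH); rewrite adj_sym xy !inE (negPf xH) (negPf xX) => /(_ isT).
Qed.

(** A vertex of K in R has more than |X| neighbours, all in K or X and outside R, so K has more
    vertices outside R than X has in R. This is used for R the complement of Q; the same count with
    R = Q shows that K has a vertex outside Q. *)
Lemma component_sides (K Q : {set G}) : bipartition Q ->
  (exists x, x \in K) -> (forall x y, x \in K -> adj x y -> y \in K :|: X) ->
  #|X :\: Q| < #|K :&: Q|.
Proof.
move=> bQ [x xK] Kcl.
have side R y : bipartition R -> y \in K -> y \in R -> #|X :&: R| < #|K :\: R|.
  move=> bR yK yR; have := degree_cover bR yR (fun v => @Kcl y v yK).
  rewrite setDUl => d; have := leq_trans d (leq_card_setU _ _).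
  have := deg_gt y; rewrite -(cardsID R X); lia.
have [y yK yQ] : exists2 y, y \in K & y \notin Q.
  case xQ: (x \in Q); last by exists x; rewrite ?xQ.
  have : 0 < #|K :\: Q| by apply: leq_ltn_trans (side Q x bQ xK xQ).
  by rewrite card_gt0 => /set0Pn[y]; rewrite inE => /andP[yQ yK]; exists y.
have := side (~: Q) y (bipartitionC bQ) yK; rewrite inE yQ => /(_ isT).
by rewrite !setDE setCK.
Qed.

Lemma edge_sum_le_two_components :
  edge_sum w P <= W * (#|G|.-1./2 * #|G|./2 + #|X|).
Proof.
have cP := bipartitionC bP.
have closed' := component_compl_closed.
have H'ne : exists x, x \in H' by case: H'_nonempty => y; exists y; rewrite inE.
have side1 := component_sides bP H_nonempty H_closed.
have side2 := component_sides cP H_nonempty H_closed.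
have side3 := component_sides bP H'ne closed'.
have side4 := component_sides cP H'ne closed'.
rewrite !setDE setCK in side2 side4.
set a1 := #|H :&: P| in side1; set a2 := #|H' :&: P| in side3.
set b1 := #|H :&: ~: P| in side2; set b2 := #|H' :&: ~: P| in side4.
set x1 := #|X :&: P| in side2 side4; set x2 := #|X :\: P| in side1 side3.
have split3 (Q : {set G}) : #|Q| = #|H :&: Q| + #|H' :&: Q| + #|X :&: Q|.
  rewrite -(cardsID H Q) -(cardsID X (Q :\: H)).
  have -> : (Q :\: H) :&: X = X :&: Q.
    apply/setP => z; rewrite !inE andbC; case zX: (z \in X) => //=.
    by rewrite (disjointFl HX zX).
  have -> : (Q :\: H) :\: X = H' :&: Q.
    by apply/setP => z; rewrite !inE; do 3 case: (z \in _).
  by rewrite [Q :&: H]setIC; lia.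
have cardP : #|P| = a1 + a2 + x1 by exact: split3.
have cardQ : #|~: P| = b1 + b2 + x2 by rewrite /x2 setDE; exact: split3.
have nE : a1 + a2 + x1 + (b1 + b2 + x2) = #|G| by rewrite -cardP -cardQ cardsC.
have xk : x1 + x2 = #|X| by rewrite /x1 /x2 cardsID.
(* A vertex of H or H' in [P] has at most b1 + x2 or b2 + x2 edges, each of weight at most W. Each
   of the x1 vertices of X in [P] is charged W per vertex of the opposite side, and W more for each
   of the x2 lying in X. *)
apply: leq_trans (_ : W * (x1 * (b1 + b2 + x2 + x2) + (a1 * (b1 + x2) + a2 * (b2 + x2))) <= _); last first.
  by rewrite leq_mul2l (two_component_bound xk side1 side3 side2 side4 nE) orbT.
have degH (Q K : {set G}) u : bipartition Q -> u \in Q -> u \in K ->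
    (forall x y, x \in K -> adj x y -> y \in K :|: X) ->
    degree u <= #|K :&: ~: Q| + #|X :&: ~: Q|.
  move=> bQ uQ uK Kcl; apply: leq_trans (degree_cover bQ uQ (fun v => @Kcl u v uK)) _.
  by rewrite setDUl -!setDE leq_card_setU.
(* A vertex outside X misses the other piece on the opposite side, so an edge not inside X has
   degree sum at most n - 1. *)
have deg_lt (Q : {set G}) u : bipartition Q -> u \in Q -> u \notin X ->
    0 < #|H :&: ~: Q| -> 0 < #|H' :&: ~: Q| -> degree u < #|~: Q|.
  move=> bQ uQ uX h1 h2; rewrite (split3 (~: Q)).
  case uH: (u \in H); first by have := degH Q H u bQ uQ uH H_closed; lia.
  have uH' : u \in H' by rewrite !inE uH.
  by have := degH Q H' u bQ uQ uH' closed'; lia.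
have off u v : u \in P -> adj u v -> ~~ ((u \in X) && (v \in X)) ->
    w (degree u) (degree v) <= W.
  move=> uP uv nX; apply: W_off.
  have vP : v \in ~: P by move/bP: uv; rewrite uP inE; case: (v \in P).
  have := degree_side bP uP; have := degree_side cP vP; rewrite setCK cardP cardQ.
  case/nandP: nX => [uX|vX].
    by have := deg_lt P u bP uP uX; rewrite cardQ; lia.
  by have := deg_lt _ v cP vP vX; rewrite setCK cardP; lia.
have off_sum u c : u \in P -> u \notin X -> degree u <= c ->
    \sum_(v | adj u v) w (degree u) (degree v) <= c * W.
  move=> uP uX uc; apply: leq_trans (_ : degree u * W <= _); last by rewrite leq_mul2r uc orbT.
  by rewrite -sum_adj_const; apply: leq_sum => v uv; apply: off => //; rewrite (negPf uX).
have on_sum u : u \in P -> u \in X ->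
    \sum_(v | adj u v) w (degree u) (degree v) <= (b1 + b2 + x2 + x2) * W.
  move=> uP uX; apply: leq_trans (_ : \sum_(v in ~: P) (W + (v \in X) * W) <= _).
    rewrite [X in _ <= X](bigID (adj u)) /=; apply: leq_trans (leq_addr _ _).
    rewrite (eq_bigl (fun v => (v \in ~: P) && adj u v)); last first.
      move=> v; case uv: (adj u v); rewrite ?andbF // andbT.
      by move/bP: uv; rewrite uP inE; case: (v \in P).
    apply: leq_sum => v /andP[vP uv]; case vX: (v \in X).
      rewrite mul1n addnn -mul2n; apply: W_on; rewrite -nE -cardP -cardQ addnC.
      apply: leq_add; last exact: degree_side.
      by have := degree_side cP vP; rewrite setCK.
    by rewrite addn0; apply: off; rewrite ?vX ?andbF.
  rewrite big_split /= sum_nat_const cardQ -big_distrl /= -mulnDl.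
  rewrite leq_mul2r; apply/orP; right; rewrite leq_add2l /x2 -sum1_card.
  rewrite [X in _ <= X]big_mkcond [X in X <= _]big_mkcond /=; apply: leq_sum => v _.
  by rewrite !inE; case: (v \in P) => //; case: (v \in X).
have sumP (c : G -> nat) : \sum_(u in P) c u =
   \sum_(u in X :&: P) c u + (\sum_(u in H :&: P) c u + \sum_(u in H' :&: P) c u).
  rewrite (bigID [in X]) /=; congr (_ + _).
    by apply: eq_bigl => z; rewrite inE andbC.
  rewrite (bigID [in H]) /=; congr (_ + _); apply: eq_bigl => z; rewrite !inE.
    by case zH: (z \in H); rewrite ?andbF // (disjointFr HX zH) !andbT.
  by case: (z \in H); case: (z \in X); rewrite ?andbF ?andbT.
rewrite /edge_sum sumP [W * _]mulnC !mulnDl -!mulnA.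
have bound (A : {set G}) c : (forall u, u \in A :&: P ->
    \sum_(v | adj u v) w (degree u) (degree v) <= c) ->
    \sum_(u in A :&: P) \sum_(v | adj u v) w (degree u) (degree v) <= #|A :&: P| * c.
  by move=> h; rewrite -sum_nat_const; apply: leq_sum.
apply: leq_add; [|apply: leq_add]; apply: bound => u; rewrite in_setI.
- by move=> /andP[uX uP]; apply: on_sum.
- move=> /andP[uH uP]; apply: off_sum; rewrite ?(disjointFr HX uH) //.
  by have := degH P H u bP uP uH H_closed; rewrite -[X :&: _]setDE.
- move=> /andP[uH uP]; apply: off_sum => //.
    by move: uH; rewrite !inE => /norP[].
  by have := degH P H' u bP uP uH closed'; rewrite -[X :&: _]setDE.
Qed.

End TwoComponents.

End UpperBounds.

(** * Isomorphisms and the extremal graph *)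

Lemma isomorphic_sym G H : isomorphic G H -> isomorphic H G.
Proof.
case=> f [g fK gK] fE; exists g; first by exists f.
by move=> x y; rewrite -fE !gK.
Qed.

Lemma isomorphic_inj (G H : sgraph) (f : H -> G) : #|G| = #|H| ->
  injective f -> (forall x y, adj (f x) (f y) = adj x y) -> isomorphic G H.
Proof.
move=> GH f_inj fE; apply: isomorphic_sym; exists f => //.
by apply: inj_card_bij; rewrite ?GH.
Qed.

Section Extremal.
Variables k s q : nat.
Hypothesis kq : k <= q.
(** With q - k as last parameter, the sides (v with A, and C with B) have s + 1 and q vertices. *)
Let J := join1 k s (q - k).

Lemma card_join1 : #|J| = s + q + 1.
Proof. rewrite !card_sum card_unit !card_ord; lia. Qed.

Definition join1_side : {set J} :=
  [set x : J | match x with inr (inl _) | inr (inr (inl _)) => true | _ => false end].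

Lemma join1_bipartition : bipartition join1_side.
Proof. by move=> [?|[?|[?|?]]] [?|[?|[?|?]]]; rewrite !inE. Qed.

Lemma sum_join1 (F : J -> nat) :
  \sum_x F x = \sum_i F (inl i) + (F (inr (inl tt)) +
    (\sum_i F (inr (inr (inl i))) + \sum_i F (inr (inr (inr i))))).
Proof.
rewrite [LHS](@big_sumType _ _ _ 'I_k (unit + Kpq s (q - k))%type predT) /=.
congr (_ + _).
rewrite [LHS](@big_sumType _ _ _ unit (Kpq s (q - k)) predT) /=.
rewrite [X in _ + X = _](@big_sumType _ _ _ 'I_s 'I_(q - k) predT) /=.
by rewrite (big_pred1 tt) //; case.
Qed.

Lemma degree_join1 (x : J) : degree x =
  match x with
  | inl _ => s.+1
  | inr (inl _) => k
  | inr (inr (inl _)) => q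
  | inr (inr (inr _)) => s
  end.
Proof.
rewrite /degree -sum1dep_card big_mkcond sum_join1.
by case: x => [?|[?|[?|?]]] /=; rewrite !sum_nat_const !card_ord; lia.
Qed.

Lemma edge_sum_join1 w : edge_sum w join1_side = extremal_value w k s q.
Proof.
(* The default branch leaves the rows outside [join1_side] as they are; the edge sum ignores
   them. *)
have row (u : J) : \sum_(v | adj u v) w (degree u) (degree v) =
  match u with inr (inl _) => k * w k s.+1
  | inr (inr (inl _)) => k * w q s.+1 + (q - k) * w q s
  | _ => \sum_(v | adj u v) w (degree u) (degree v) end.
  case: u => [?|[?|[?|?]]] //; rewrite big_mkcond sum_join1 !degree_join1 /=;
    (under eq_bigr do rewrite degree_join1);
    try (under [X in _ + (_ + (_ + X))]eq_bigr do rewrite degree_join1);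
    by rewrite !sum_nat_const !card_ord; lia.
rewrite /edge_sum; under eq_bigr do rewrite row.
rewrite big_mkcond sum_join1 !inE /=.
under eq_bigr do rewrite inE /=.
under [X in _ + (_ + (X + _))]eq_bigr do rewrite inE /=.
under [X in _ + (_ + (_ + X))]eq_bigr do rewrite inE /=.
by rewrite !sum_nat_const !card_ord /extremal_value; lia.
Qed.

(** Fewer than k deletions spare some c in C and, as k <= s, some a in A. Then v and A reach c
    directly, C and B through a. *)
Lemma kconnected_join1 : 0 < k <= s -> kconnected J k.
Proof.
move=> /andP[k0 ks]; apply/forallP => X; apply/implyP => Xk.
have avoid (f : 'I_k -> J) : injective f -> exists i, f i \notin X.
  move=> f_inj; apply/existsP; rewrite -negb_forall; apply: contraL Xk => /forallP h.
  rewrite -leqNgt -[k in k <= _]card_ord -cardsT -(card_imset _ f_inj).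
  by apply/subset_leq_card/subsetP => _ /imsetP[i _ ->].
have [c cX] := avoid inl inl_inj.
have [a aX] := avoid (fun i => inr (inr (inl (widen_ord ks i)))) ltac:(by move=> i j [] /val_inj).
set c' : delete X := Sub (inl c : J) cX.
set a' : delete X := Sub (inr (inr (inl (widen_ord ks a))) : J) aX.
have csym : connect_sym (@adj (delete X)) by apply/sym_connect_sym/adj_sym.
have ca : connect (@adj (delete X)) c' a' by apply: connect1.
have toc (x : delete X) : connect (@adj (delete X)) x c'.
  case: x => -[i|[[]|[i|i]]] xX.
  - by apply: (@connect_trans _ _ a'); [exact: connect1 | rewrite csym].
  - exact: connect1.
  - exact: connect1.
  - by apply: (@connect_trans _ _ a'); [exact: connect1 | rewrite csym].
apply/forallP => x; apply/forallP => y.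
by apply: connect_trans (toc x) _; rewrite csym.
Qed.

Lemma join1_in_class : 0 < k <= s -> in_class (s + q + 1) k J.
Proof.
move=> ks; split; first exact: card_join1.
  by apply/bipartitionP; exists join1_side; apply: join1_bipartition.
apply: connectivity_eq; first by rewrite card_join1; lia.
  exact: kconnected_join1.
by exists (inr (inl tt)); rewrite degree_join1.
Qed.

(** Nothing is left to choose: C is the neighbourhood of [v0], A the rest of its side, B the rest of
    the other side. *)
Lemma isomorphic_join1 (G : sgraph) (P : {set G}) v0 : bipartition P -> v0 \in P ->
  degree v0 = k -> #|P| = s.+1 -> #|~: P| = q ->
  (forall u v, u \in P -> u != v0 -> v \notin P -> adj u v) -> isomorphic G J.
Proof.
move=> bP v0P dv0 Ps Pq full.
pose C := [set v | adj v0 v].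
have Ck : #|C| = k by [].
have sub_CP : C \subset ~: P.
  by apply/subsetP => v; rewrite !inE => /bP; rewrite v0P; case: (v \in P).
pose A := P :\ v0; pose B := ~: P :\: C.
have As : #|A| = s by move: Ps; rewrite (cardsD1 v0) v0P => -[].
have Bq : #|B| = q - k by rewrite cardsD (setIidPr sub_CP) Pq Ck.
pose f (x : J) := match x with
  | inl i => nth v0 (enum C) i
  | inr (inl _) => v0
  | inr (inr (inl i)) => nth v0 (enum A) i
  | inr (inr (inr i)) => nth v0 (enum B) i
  end.
have memC (i : 'I_k) : nth v0 (enum C) i \in C by rewrite -mem_enum mem_nth // -cardE Ck.
have memA (i : 'I_s) : nth v0 (enum A) i \in A by rewrite -mem_enum mem_nth // -cardE As.
have memB (i : 'I_(q - k)) : nth v0 (enum B) i \in B.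
  by rewrite -mem_enum mem_nth // -cardE Bq.
have noPP x y : x \in P -> y \in P -> adj x y = false.
  by move=> xP yP; apply: contraTF xP => /bP; rewrite yP; case: (x \in P).
have noQQ x y : x \notin P -> y \notin P -> adj x y = false.
  by move=> xP yP; apply: contraNF xP => /bP; rewrite (negPf yP); case: (x \in P).
have CP i : nth v0 (enum C) (i : 'I_k) \notin P by have := subsetP sub_CP _ (memC i); rewrite inE.
have CA i : adj v0 (nth v0 (enum C) (i : 'I_k)) by have := memC i; rewrite inE.
have AP i : nth v0 (enum A) (i : 'I_s) \in P by have := memA i; rewrite inE => /andP[].
have Av i : nth v0 (enum A) (i : 'I_s) != v0 by have := memA i; rewrite !inE => /andP[].
have BP i : nth v0 (enum B) (i : 'I_(q - k)) \notin P by have := memB i; rewrite !inE => /andP[].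
have BA i : adj v0 (nth v0 (enum B) (i : 'I_(q - k))) = false.
  by have := memB i; rewrite !inE => /andP[/negPf].
have adjAC i j : adj (nth v0 (enum A) (i : 'I_s)) (nth v0 (enum C) (j : 'I_k)).
  exact: full.
have adjAB i j : adj (nth v0 (enum A) (i : 'I_s)) (nth v0 (enum B) (j : 'I_(q - k))).
  exact: full.
have fE (x y : J) : adj (f x) (f y) = adj x y.
  case: x y => [i|[[]|[i|i]]] [j|[[]|[j|j]]] /=;
    rewrite ?(noPP _ _ (AP _) (AP _)) ?(noPP _ _ v0P (AP _)) ?(noPP _ _ (AP _) v0P)
      ?(noQQ _ _ (CP _) (CP _)) ?(noQQ _ _ (CP _) (BP _)) ?(noQQ _ _ (BP _) (CP _))
      ?(noQQ _ _ (BP _) (BP _)) ?adj_irrefl ?CA ?BA ?adjAC ?adjAB //;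
    by rewrite adj_sym ?CA ?BA ?adjAC ?adjAB.
have f_inj : injective f.
  have sep (T : {set G}) x y : x \in T -> y \notin T -> x <> y.
    by move=> xT yT e; rewrite e (negPf yT) in xT.
  have nthI (T : {set G}) m : #|T| = m -> forall i j : 'I_m,
      nth v0 (enum T) i = nth v0 (enum T) j -> i = j.
    move=> Tm i j /eqP; rewrite nth_uniq ?enum_uniq -?cardE ?Tm // => /eqP.
    exact: val_inj.
  have vC i : v0 <> nth v0 (enum C) (i : 'I_k) by apply: sep v0P (CP i).
  have vB i : v0 <> nth v0 (enum B) (i : 'I_(q - k)) by apply: sep v0P (BP i).
  have vA i : v0 <> nth v0 (enum A) (i : 'I_s) by apply/eqP; rewrite eq_sym.
  have AC i j : nth v0 (enum A) (i : 'I_s) <> nth v0 (enum C) (j : 'I_k) by apply: sep (AP i) (CP j).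
  have AB i j : nth v0 (enum A) (i : 'I_s) <> nth v0 (enum B) (j : 'I_(q - k)) by apply: sep (AP i) (BP j).
  have BC i j : nth v0 (enum C) (i : 'I_k) <> nth v0 (enum B) (j : 'I_(q - k)).
    by apply: sep (memC i) _; rewrite inE BA.
  move=> [i|[[]|[i|i]]] [j|[[]|[j|j]]] //= e;
    first [by case: (vA _ e) | by case: (vB _ e) | by case: (vC _ e)
      | by case: (vA _ (esym e)) | by case: (vB _ (esym e)) | by case: (vC _ (esym e))
      | by case: (AB _ _ e) | by case: (AC _ _ e) | by case: (BC _ _ e)
      | by case: (AB _ _ (esym e)) | by case: (AC _ _ (esym e))
      | by case: (BC _ _ (esym e))
      | by rewrite (nthI _ _ Ck _ _ e) | by rewrite (nthI _ _ As _ _ e)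
      | by rewrite (nthI _ _ Bq _ _ e)].
apply: isomorphic_inj f_inj fE.
by rewrite -(cardsC P) Ps Pq card_join1; lia.
Qed.

End Extremal.

(** * Complete bipartite graphs and side sizes *)

Lemma isomorphic_Kpq (G : sgraph) (P : {set G}) : bipartition P ->
  (forall u v, u \in P -> v \notin P -> adj u v) -> isomorphic G (Kpq #|P| #|~: P|).
Proof.
move=> bP full.
pose f (x : Kpq #|P| #|~: P|) : G :=
  match x with inl i => enum_val i | inr i => enum_val i end.
have Q (i : 'I_#|~: P|) : enum_val i \notin P by have := enum_valP i; rewrite inE.
have R (i : 'I_#|P|) : enum_val i \in P := enum_valP i.
have fE x y : adj (f x) (f y) = adj x y.
  case: x y => i [] j /=; last first.
  - by apply: contraNF (Q i) => /bP; rewrite (negPf (Q j)); case: (_ \in P).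
  - by rewrite adj_sym full.
  - by rewrite full.
  by apply: contraTF (R i) => /bP; rewrite (R j); case: (_ \in P).
apply: isomorphic_inj fE; first by rewrite card_sum !card_ord cardsC.
have sep i j : enum_val (i : 'I_#|P|) <> enum_val (j : 'I_#|~: P|).
  by move=> e; have := R i; rewrite e (negPf (Q j)).
by move=> [i|i] [j|j] /= => [/enum_val_inj->|/sep|/esym/sep|/enum_val_inj->].
Qed.

(** A vertex has k neighbours on the opposite side, and any of these has k neighbours back. *)
Lemma min_degree_sides (G : sgraph) (P : {set G}) k : 0 < k -> 0 < #|G| ->
  bipartition P -> (forall v : G, k <= degree v) -> (k <= #|P|) /\ (k <= #|~: P|).
Proof.
move=> k0 /card_gt0P[x _] bP kd.
wlog xP : P bP / x \in P => [W|].
  case xP: (x \in P); first exact: W.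
  by have := W _ (bipartitionC bP); rewrite inE xP setCK => /(_ isT)[].
have kx := leq_trans (kd x) (degree_side bP xP); split=> //.
have [y yP] : exists y, y \in ~: P by apply/card_gt0P; apply: leq_trans kx.
by have := leq_trans (kd y) (degree_side (bipartitionC bP) yP); rewrite setCK.
Qed.

(** Both sides have exactly k vertices, so minimum degree k joins each vertex to the whole opposite
    side. *)
Lemma balanced_max_connectivity (G : sgraph) k : 0 < k -> in_class (2 * k) k G ->
  isomorphic G (Kpq k k).
Proof.
move=> k0 [Gn /bipartitionP[P bP] /(connectivity_pos k0)[kG kc _]].
have kd v : k <= degree v := kconnected_degree v kc kG.
have [P1 P2] := min_degree_sides k0 (leq_ltn_trans (leq0n k) kG) bP kd.
have PP := cardsC P; rewrite Gn in PP.
have Pk : #|P| = k by lia.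
have Qk : #|~: P| = k by lia.
rewrite -{1}Pk -Qk; apply: isomorphic_Kpq => // u v uP vP.
have /eqP e : [set v | adj u v] == ~: P.
  rewrite eqEcard Qk (kd u) andbT; apply/subsetP => z; rewrite !inE => /bP.
  by rewrite uP; case: (z \in P).
have : v \in ~: P by rewrite inE.
by rewrite -e inE.
Qed.

(** * Maximizers *)

Lemma maximizer_join1 (w : nat -> nat -> nat) (M : sgraph -> nat) (G : sgraph) n k :
  (forall (H : sgraph) (P : {set H}), bipartition P -> M H = edge_sum w P) ->
  (forall x y x' y', x <= x' -> y <= y' -> w x y <= w x' y') ->
  (forall x y, 0 < x -> 0 < y -> 0 < w x y) ->
  (forall x y, x + y <= n.-1 -> w x y <= w n.-1./2 n./2) ->
  (forall x y, x + y <= n -> w x y <= 2 * w n.-1./2 n./2) ->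
  (forall s q, k <= q -> s + q = n.-1 -> s != n./2 ->
     extremal_value w k s q < extremal_value w k n./2 n.-1./2) ->
  w n.-1./2 n./2 * (n.-1./2 * n./2 + k) < extremal_value w k n./2 n.-1./2 ->
  2 < n -> 0 < k <= n.-1./2 -> maximizes M (in_class n k) G ->
  isomorphic G (join1 k n./2 (n.-1./2 - k)).
Proof.
move=> ME w_mono w_gt0 W_off W_on lt_ext gt_ext n2 /andP[k0 kn] [[Gn bG cG] maxG].
have /bipartitionP[P bP] := bG.
have [kG kc nkc] := connectivity_pos k0 cG.
have kd v : k <= degree v := kconnected_degree v kc kG.
(* The claimed graph lies in the class, so a maximizer has at least its index. *)
have Mge : extremal_value w k n./2 n.-1./2 <= M G.
  rewrite -(edge_sum_join1 _ kn) -(ME _ _ (@join1_bipartition k n./2 n.-1./2)).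
  apply: maxG; have -> : n = n./2 + n.-1./2 + 1 by lia.
  have -> : (n./2 + n.-1./2 + 1)./2 = n./2 by lia.
  have -> : (n./2 + n.-1./2 + 1).-1./2 = n.-1./2 by lia.
  by apply: join1_in_class => //; lia.
case: (boolP [exists v : G, degree v <= k]) => [/existsP[v vk]|/existsPn dk].
  wlog vP : P bP / v \in P => [W|].
    case vP: (v \in P); first exact: W vP.
    by apply: W (bipartitionC bP) _; rewrite inE vP.
  have dv : degree v = k by apply/eqP; rewrite eqn_leq vk kd.
  have := edge_sum_le_extremal bP w_mono w_gt0 vP (degree_side bP vP).
  rewrite -(ME _ _ bP) dv; set s := #|P :\ v|; set q := #|~: P|; set m := \sum_(u in P | _) _.
  have Ps : #|P| = s.+1 by rewrite (cardsD1 v) vP.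
  have sq : s + q = n.-1 by rewrite -Gn -(cardsC P) Ps.
  have kq : k <= q by rewrite -dv degree_side.
  (* Any other split stays strictly below the claimed graph; at this one the count [m] of missing
     edges must vanish. *)
  move=> le_ext; have s0 : s = n./2.
    by apply/eqP/negPn/negP => /(lt_ext _ _ kq sq); lia.
  have q0 : q = n.-1./2 by lia.
  have m0 : m = 0 by move: le_ext; rewrite s0 q0; lia.
  rewrite -s0 -q0; apply: isomorphic_join1 bP vP dv Ps _ _ => // x y xP xv yP.
  move/eqP: m0; rewrite sum_nat_eq0 => /forallP/(_ x); rewrite xP xv /=.
  by rewrite sum_nat_eq0 => /forallP/(_ y); rewrite yP /= implybF negbK.
(* As G is k-connected but not (k + 1)-connected, a separating set of exactly k vertices exists. *)
have : ~~ kconnected G k.+1 by apply: nkc; rewrite ltnSn Gn; lia.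
rewrite negb_forall => /existsP[X]; rewrite negb_imply ltnS => /andP[Xk nX].
have Xk' : #|X| = k.
  apply/eqP; rewrite eqn_leq Xk leqNgt; apply: contra nX.
  by move/forallP/(_ X)/implyP: kc.
have [H [HX [Hne H'ne]] Hcl] := disconnected_delete nX.
have deg_gt (x : G) : #|X| < degree x by rewrite Xk' ltnNge.
have W_off' x y : x + y <= #|G|.-1 -> w x y <= w n.-1./2 n./2 by rewrite Gn; apply: W_off.
have W_on' x y : x + y <= #|G| -> w x y <= 2 * w n.-1./2 n./2 by rewrite Gn; apply: W_on.
have := edge_sum_le_two_components bP W_off' W_on' HX Hne H'ne Hcl deg_gt.
by rewrite -(ME _ _ bP) Gn Xk'; lia.
Qed.

Lemma zagreb_maximizer_join1 (n k : nat) (G : sgraph) :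
  2 < n -> 0 < k <= n.-1./2 ->
  maximizes zagreb1 (in_class n k) G \/ maximizes zagreb2 (in_class n k) G ->
  isomorphic G (join1 k n./2 (n.-1./2 - k)).
Proof.
move=> n2 kn; have /andP[k0 kn'] := kn; case.
  apply: (maximizer_join1 (w := addn)) => //.
  - exact: zagreb1_edge_sum.
  - by move=> *; apply: leq_add.
  - by move=> *; rewrite addn_gt0; lia.
  - by move=> *; lia.
  - by move=> *; lia.
  - by move=> s q kq; apply: extremal_valueD_lt; rewrite ?k0.
  - exact: extremal_valueD_gt.
apply: (maximizer_join1 (w := muln)) => //.
- exact: zagreb2_edge_sum.
- by move=> *; apply: leq_mul.
- by move=> *; rewrite muln_gt0; lia.
- exact: muln_half_pred.
- by move=> x y; apply: muln_half.
- by move=> s q kq; apply: extremal_valueM_lt; rewrite ?k0.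
- exact: extremal_valueM_gt.
Qed.

Theorem theorem2p6 (n k : nat) (G : sgraph) :
  6 <= n -> 1 <= k ->
  maximizes zagreb1 (in_class n k) G \/ maximizes zagreb2 (in_class n k) G ->
  (odd n ->
     isomorphic G (join1 k ((n - 1) %/ 2) ((n - 1 - 2 * k) %/ 2))) /\
  (~~ odd n ->
     (k = n %/ 2 -> isomorphic G (Kpq (n %/ 2) (n %/ 2))) /\
     (k <= n %/ 2 - 1 ->
        isomorphic G (join1 k (n %/ 2) ((n - 2 - 2 * k) %/ 2)))).
Proof.
move=> n6 k0 maxG.
have n2 : 2 < n by lia.
have inG : in_class n k G by case: maxG => [[]|[]].
split=> [on|en].
  (* Both sides have at least k vertices, so 2 k <= n, which for odd n gives k <= (n - 1) / 2. *)
  have [Gn /bipartitionP[P bP] /(connectivity_pos k0)[kG kc _]] := inG.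
  have kd v : k <= degree v := kconnected_degree v kc kG.
  have [] := min_degree_sides k0 (leq_ltn_trans (leq0n k) kG) bP kd.
  have := cardsC P; rewrite Gn => cP kP kQ.
  have -> : (n - 1) %/ 2 = n./2 by lia.
  have -> : (n - 1 - 2 * k) %/ 2 = n.-1./2 - k by lia.
  by apply: zagreb_maximizer_join1 => //; lia.
split=> [kE|kn].
  rewrite -kE; apply: balanced_max_connectivity => //.
  by have <- : n = 2 * k by lia.
have -> : n %/ 2 = n./2 by lia.
have -> : (n - 2 - 2 * k) %/ 2 = n.-1./2 - k by lia.
by apply: zagreb_maximizer_join1 => //; lia.
Qed.
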